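(* Let $X$ be a Banach space with nontrivial infratype $p$ (i.e. infratype $p>1$ with some constant $C$) and let $F:[0,1]\to 2^{X}\setminus\{\varnothing\}$ be a bounded multifunction. Then $I(F)=I(\operatorname{conv}F)$.
   Context: A Banach space $X$ has infratype $p$ with constant $C$ if $\min_{a_k=\pm1}\left\|\sum_{k=1}^n a_kx_k\right\|\le C\left(\sum_{k=1}^n\|x_k\|^p\right)^{1/p}$ for every finite collection $\{x_k\}_{k=1}^n\subset X$. It has nontrivial infratype if it has infratype $p$ for some $p>1$ with some constant $C$. For subsets $A,B$ of a Banach space $X$ and $\lambda\in\mathbb{R}$: $A+B=\{a+b: a\in A, b\in B\}$, $\lambda A=\{\lambda a: a\in A\}$. A tagged partition $(\Gamma,T)$ of $[0,1]$ consists of a partition $\Gamma=\{\Delta_i\}_{i=1}^n$ of $[0,1]$ into (non-overlapping closed) segments $\Delta_i=[a_i,b_i]$ and tags $T=\{\xi_i\}_{i=1}^n$, $\xi_i\in\Delta_i$. Write $|\Delta_i|=b_i-a_i$ and $d(\Gamma)=\max_i|\Delta_i|$. A multifunction is a map $F:[0,1]\to 2^X\setminus\{\varnothing\}$. It is bounded if $M(F)=\sup\{\|a\|: a\in F(t), t\in[0,1]\}<\infty$. Its Riemann sums are $S(F,\Gamma,T)=\sum_{i=1}^n|\Delta_i|F(\xi_i)$ (Minkowski sum). The multifunction $\operatorname{conv}F$ is defined by $(\operatorname{conv}F)(t)=\operatorname{conv}(F(t))$ (convex hull). The Hausdorff distance between non-empty sets is $d_H(A,B)=\max\{\sup_{a\in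 A}d(a,B),\sup_{b\in B}d(b,A)\}$. For bounded $F$, $I(F)$ is the collection of all non-empty closed subsets $A\subset X$ for which there is a sequence of tagged partitions $(\Gamma_k,T_k)$ with $d(\Gamma_k)\to0$ and $d_H(S(F,\Gamma_k,T_k),A)\to0$ as $k\to\infty$. *)

(* Defs.v *)
From HB Require Import structures.
From mathcomp Require Import all_boot all_order all_algebra.
From mathcomp Require Import all_classical all_reals all_analysis.

Set Implicit Arguments.
Unset Strict Implicit.
Unset Printing Implicit Defensive.

Import Order.TTheory GRing.Theory Num.Theory.
Import numFieldNormedType.Exports.

Local Open Scope classical_set_scope.
Local Open Scope ring_scope.

(* The default value of the big minimum is the term with all signs [+1]; being
   one of the terms, it does not affect the minimum over the [2 ^ n] choices. *)
Definition has_infratype {R : realType} (X : normedModType R) (p C : R) : Prop :=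
  forall (n : nat) (x : 'I_n -> X),
    \big[Num.min / `|\sum_(k < n) x k|]_(a : {ffun 'I_n -> bool})
        `|\sum_(k < n) (-1) ^+ a k *: x k|
    <= C * (\sum_(k < n) `|x k| `^ p) `^ p^-1.

Definition nontrivial_infratype {R : realType} (X : normedModType R) : Prop :=
  exists p C : R, 1 < p /\ has_infratype X p C.

Definition minkowski_add {R : realType} {X : normedModType R}
    (A B : set X) : set X :=
  [set a + b | a in A & b in B].

Definition minkowski_scale {R : realType} {X : normedModType R}
    (l : R) (A : set X) : set X :=
  [set l *: a | a in A].

Definition convex_hull {R : realType} {X : normedModType R} (A : set X) : set X :=
  smallest (@convex_set R X) A.

(* [cuts = [:: t_1; ...; t_n]] with [0 < t_1 < ... < t_n = 1] encodes the
   partition into the [n] segments from [t_i] to [t_{i+1}], where [t_0 = 0]. *)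
Record tagged_partition (R : realType) := TaggedPartition {
  cuts : seq R ;
  tags : seq R ;
  cuts_partition : itv_partition 0 1 cuts ;
  size_tags : size tags = size cuts ;
  tags_in : forall i, (i < size cuts)%N ->
    (0 :: cuts)`_i <= tags`_i <= cuts`_i
}.

Definition seg_length {R : realType} (P : tagged_partition R) (i : nat) : R :=
  (cuts P)`_i - (0 :: cuts P)`_i.

Definition mesh {R : realType} (P : tagged_partition R) : R :=
  \big[Num.max / 0]_(i < size (cuts P)) seg_length P i.

(* A multifunction on [0, 1] is represented by a function on [R] of which only
   the values on [0, 1] are used. *)
Definition norm_sup {R : realType} {X : normedModType R}
    (F : R -> set X) : \bar R :=
  ereal_sup [set `|a|%:E | a in \bigcup_(t in `[0, 1]) F t].

Definition bounded_multifunction {R : realType} {X : normedModType R}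
    (F : R -> set X) : Prop :=
  (norm_sup F < +oo)%E.

Definition riemann_sum {R : realType} {X : normedModType R}
    (F : R -> set X) (P : tagged_partition R) : set X :=
  \big[minkowski_add / [set 0]]_(i < size (cuts P))
     minkowski_scale (seg_length P i) (F (tags P)`_i).

(* For nonempty sets; extended-real valued, as the sets may be unbounded. *)
Definition hausdorff_dist {R : realType} {X : normedModType R}
    (A B : set X) : \bar R :=
  maxe (ereal_sup [set edist_inf B a | a in A])
       (ereal_sup [set edist_inf A b | b in B]).

Definition riemann_limits {R : realType} {X : normedModType R}
    (F : R -> set X) : set (set X) :=
  [set A | A !=set0 /\ closed A /\
    exists P : nat -> tagged_partition R,
      mesh (P k) @[k --> \oo] --> 0 /\
      hausdorff_dist (riemann_sum F (P k)) A @[k --> \oo] --> 0%E].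

(* Main.v *)
(** The Riemann sums of [F] and of [conv F] over the same tagged partition are at
    Hausdorff distance at most of order [mesh `^ (1 - p^-1)], uniformly, so they
    have the same limits.  It suffices to replace points [x i] obtained from
    [F (xi_i)] by iterated midpoints (these are dense in the convex hull) by
    points of [F (xi_i)], with an error on [\sum_i |Delta_i| *: x i] that does
    not depend on the number of iterations.  Undoing the iterations one at a time,
    innermost midpoints first, each step chooses one endpoint of every remaining
    midpoint; by the infratype inequality the best choice costs
    [O(w `^ (1 - p^-1))], where [w] bounds the weights.  At depth [j] one has
    [w = 2 ^- j * mesh], and the costs form a convergent geometric series since
    [p > 1]. *)
Require Import Defs.
From HB Require Import structures.
From mathcomp Require Import all_boot all_order all_algebra.
From mathcomp Require Import all_classical all_reals all_analysis.
From mathcomp Require Import ring lra.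
Import Order.TTheory GRing.Theory Num.Theory.
Import numFieldNormedType.Exports.
Local Open Scope classical_set_scope.
Local Open Scope ring_scope.

(** * Sign choices provided by infratype *)

(** A minimum over finitely many sign patterns is attained, and enumeration carries the inequality
    over to any finite index type, such as the disjoint sums met later. With [|C|] the constant is
    nonnegative, so the bound is monotone in the sum. *)
Lemma infratype_signs (R : realType) (X : normedModType R) (p C : R)
    (hC : has_infratype X p C) (I : finType) (x : I -> X) :
  exists s : I -> bool,
    `|\sum_i (-1) ^+ s i *: x i| <= `|C| * (\sum_i `|x i| `^ p) `^ p^-1.
Proof.
have /bigmin_leP := hC #|I| (x \o enum_val).
have sumE (V : nmodType) (F : I -> V) :
    \sum_i F i = \sum_(k < #|I|) F (enum_val k).
  by rewrite (reindex (@enum_val I I)) //; apply/onW_bij/enum_val_bij.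
rewrite (sumE R).
have CC : C * (\sum_(k < #|I|) `|(x \o enum_val) k| `^ p) `^ p^-1 <=
   `|C| * (\sum_(k < #|I|) `|x (enum_val k)| `^ p) `^ p^-1.
  by apply: ler_wpM2r; [exact: powR_ge0 | exact: ler_norm].
(* The bound is met either by the default of the minimum, where all signs are [+1], or by a sign
   pattern [a]. *)
move=> [h|[a _ h]].
  exists (fun=> false); rewrite (sumE X); apply: le_trans CC; apply: le_trans h.
  by under eq_bigr do rewrite expr0 scale1r.
exists (a \o enum_rank); rewrite (sumE X); apply: le_trans CC; apply: le_trans h.
by under eq_bigr do rewrite /= enum_valK.
Qed.

(* [\sum_i w_i `^ p <= d `^ (p - 1) * \sum_i w_i] is where small weights win. *)
Lemma infratype_weighted_signs (R : realType) (X : normedModType R) (p C : R)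
    (p1 : 1 < p) (hC : has_infratype X p C) (I : finType) (w : I -> R)
    (x : I -> X) (d M : R) :
  0 <= M -> (forall i, 0 <= w i <= d) -> \sum_i w i <= 1 ->
  (forall i, `|x i| <= M) ->
  exists s : I -> bool,
    `|\sum_i (-1) ^+ s i *: (w i *: x i)| <= `|C| * M * d `^ (1 - p^-1).
Proof.
move=> M0 wd w1 xM.
have p0 : 0 < p by apply: lt_trans p1.
have [s hs] := infratype_signs _ _ _ _ hC _ (fun i => w i *: x i).
exists s; apply: le_trans hs _; rewrite -mulrA; apply: ler_wpM2l => //.
have Mp : (M `^ p * d `^ (p - 1)) `^ p^-1 = M * d `^ (1 - p^-1).
  rewrite powRM ?powR_ge0// -!powRrM mulfV ?gt_eqF// powRr1//.
  by rewrite mulrBl mulfV ?gt_eqF// mul1r.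
rewrite -Mp; apply: ge0_ler_powR.
- by rewrite invr_ge0 ltW.
- by rewrite nnegrE sumr_ge0// => i _; exact: powR_ge0.
- by rewrite nnegrE mulr_ge0// powR_ge0.
have -> : M `^ p * d `^ (p - 1) = 1 * (M `^ p * d `^ (p - 1)) by rewrite mul1r.
apply: le_trans (_ : (\sum_i w i) * (M `^ p * d `^ (p - 1)) <= _); last first.
  by apply: ler_wpM2r => //; rewrite mulr_ge0// powR_ge0.
rewrite mulr_suml; apply: ler_sum => i _.
have /andP[wi0 wid] := wd i.
rewrite normrZ (ger0_norm wi0) powRM// -(mulr_powRB1 wi0 p0) -mulrA.
apply: ler_wpM2l => //; rewrite mulrC; apply: ler_pM; rewrite ?powR_ge0//.
  by apply: ge0_ler_powR; rewrite ?nnegrE// ltW.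
apply: ge0_ler_powR; rewrite ?nnegrE//; first by rewrite subr_ge0 ltW.
exact: le_trans wid.
Qed.

(** * Iterated midpoints: rounding and density in the convex hull *)

Definition midpoints {R : realType} {X : normedModType R} (A : set X) : set X :=
  [set 2^-1 *: (y + z) | y in A & z in A].

(** Every point is its own midpoint with itself; this lets points of different depths be brought to
    a common depth. *)
Lemma sub_iter_midpoints (R : realType) (X : normedModType R) (A : set X)
    (m n : nat) :
  (m <= n)%N -> iter m midpoints A `<=` iter n midpoints A.
Proof.
move=> /subnK <-; elim: (n - m)%N => [//|k ih] x /ih xA.
exists x => //; exists x => //.
by rewrite -mulr2n -(scaler_nat _ x) scalerA mulVf ?scale1r// pnatr_eq0.
Qed.

(* Writing [x i] as the midpoint of [y i] and [z i], the induction hypothesis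
   for the doubled family with weights [w i / 2] replaces [y i] and [z i] by
   [a i] and [b i]; the infratype inequality then selects one of these two.
   The bound [d / 2] on the weights makes the errors sum geometrically. *)
Lemma iter_midpoints_rounding (R : realType) (X : normedModType R) (p C M : R)
    (p1 : 1 < p) (hC : has_infratype X p C) (M0 : 0 <= M) (m : nat)
    (I : finType) (w : I -> R) (A : I -> set X) (x : I -> X) (d : R) :
  (forall i, 0 <= w i <= d) -> \sum_i w i <= 1 -> 0 <= d ->
  (forall i a, A i a -> `|a| <= M) ->
  (forall i, iter m midpoints (A i) (x i)) ->
  exists a : I -> X, (forall i, A i (a i)) /\
    `|\sum_i w i *: (x i - a i)| <=
      `|C| * M / (1 - 2^-1 `^ (1 - p^-1)) * d `^ (1 - p^-1).
Proof.
set t : R := 1 - p^-1.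
have t0 : 0 < t by rewrite subr_gt0 invf_lt1// (lt_trans _ p1).
have q1 : 0 < 1 - 2^-1 `^ t :> R.
  by rewrite subr_gt0 -[ltRHS](congr1 (fun f => f t) (powR1 R)) gt0_ltr_powR ?nnegrE//; lra.
set K := _ / _.
have K0 : 0 <= K by rewrite !mulr_ge0// invr_ge0 ltW.
elim: m I w A x d => [|m ih] I w A x d wd w1 d0 AM hx.
  exists x; split => //; rewrite big1 => [|i _]; last by rewrite subrr scaler0.
  by rewrite normr0 mulr_ge0// powR_ge0.
have /choice[y hy] : forall i, exists y, iter m midpoints (A i) y /\
    exists2 z, iter m midpoints (A i) z & 2^-1 *: (y + z) = x i.
  by move=> i; have [y ? [z ? ?]] := hx i; exists y; split=> //; exists z.
have /choice[z hz] : forall i, exists z, iter m midpoints (A i) z /\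
     2^-1 *: (y i + z) = x i.
  by move=> i; have [_ [z ? ?]] := hy i; exists z.
pose un (T : Type) (f g : I -> T) (j : (I + I)%type) : T :=
  match j with inl i => f i | inr i => g i end.
have [|||||ab [Aab hab]] := ih (I + I)%type (un _ (fun i => 2^-1 * w i)
  (fun i => 2^-1 * w i)) (un _ A A) (un _ y z) (2^-1 * d).
- by case=> i /=; have := wd i; lra.
- rewrite big_sumType/= -!mulr_sumr; lra.
- lra.
- by case=> i /=; exact: AM.
- by case=> i /=; [exact: (hy i).1 | exact: (hz i).1].
have [||||s hs] := infratype_weighted_signs _ _ _ _ p1 hC _ w
  (fun i => 2^-1 *: (ab (inr i) - ab (inl i))) d M => //.
  move=> i; rewrite normrZ ger0_norm; last lra.
  have := AM i _ (Aab (inr i)); have := AM i _ (Aab (inl i)).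
  have := ler_normB (ab (inr i)) (ab (inl i)); lra.
exists (fun i => if s i then ab (inr i) else ab (inl i)); split.
  by move=> i; case: ifP => _; [exact: (Aab (inr i)) | exact: (Aab (inl i))].
(* With [a], [b] the two candidates and [c] the chosen one, [(y - c) + (z - c)] equals
   [(y - a) + (z - b)] plus [b - a] if [c = a], or minus it if [c = b]: choosing an endpoint is
   choosing a sign. *)
have -> : \sum_i w i *: (x i - (if s i then ab (inr i) else ab (inl i))) =
    \sum_(j : (I + I)%type) un _ (fun i => 2^-1 * w i) (fun i => 2^-1 * w i) j *:
       (un _ y z j - ab j) +
    \sum_i (-1) ^+ s i *: (w i *: (2^-1 *: (ab (inr i) - ab (inl i)))).
  rewrite big_sumType/= -!big_split/=; apply: eq_bigr => i _.
  set c := if _ then _ else _.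
  have -> : w i *: (x i - c) = (2^-1 * w i) *: ((y i - c) + (z i - c)).
    rewrite -(hz i).2 addrACA -opprD -mulr2n scalerBr scalerA (mulrC (w i)).
    by rewrite scalerBr -(scaler_nat _ c) scalerA; congr (_ - _ *: _); field.
  have -> (v : X) : (-1) ^+ s i *: (w i *: (2^-1 *: v)) =
      (2^-1 * w i) *: ((-1) ^+ s i *: v).
    by rewrite !scalerA; congr (_ *: _); ring.
  rewrite -!scalerDr; congr (_ *: _); rewrite /c; case: (s i) => /=.
    rewrite expr1 scaleN1r opprB [RHS]addrAC; congr (_ + _).
    by rewrite addrA subrK.
  rewrite expr0 scale1r -[RHS]addrA; congr (_ + _).
  by rewrite addrA subrK.
apply: le_trans (ler_normD _ _) _.
(* This fixed-point equation closes the induction: one new selection error plus the earlier error at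
   weight bound [d / 2]. *)
have KE : K = `|C| * M + K * 2^-1 `^ t.
  rewrite /K; field. by rewrite gt_eqF.
rewrite KE mulrDl addrC; apply: lerD => //.
by apply: le_trans hab _; rewrite powRM// ?mulrA//; lra.
Qed.

(** The set [G] of points approximable by iterated midpoints contains [A] and is convex, hence
    contains the hull. *)
Lemma convex_hull_midpoints (R : realType) (X : normedModType R) (A : set X)
    (x : X) (e : R) :
  convex_hull A x -> 0 < e ->
  exists m, exists2 y, iter m midpoints A y & `|x - y| < e.
Proof.
pose G : set X := [set x | forall e, 0 < e ->
  exists m, exists2 y, iter m midpoints A y & `|x - y| < e].
move=> hx; suff: G x by apply.
move: hx {e}; apply: smallest_sub; last first.
  by move=> y Ay e e0; exists 0%N, y => //; rewrite subrr normr0.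
(* Bisection on the parameter reaches every point of a segment in the limit. *)
have bisect (y u : X) m n (t : R) :
    iter m midpoints A y -> iter m midpoints A (y + u) -> 0 <= t <= 1 ->
    exists2 s, iter (n + m) midpoints A (y + s *: u) & `|t - s| <= 2^-1 ^+ n.
  move=> Ay Au; elim: n t => [|n ih] t t01.
    exists 1; first by rewrite scale1r.
    by rewrite expr0 distrC ger0_norm; lra.
  have mid (v : X) (s : R) : 2^-1 *: (v + s *: u + v) = v + (s / 2) *: u.
    rewrite addrAC -mulr2n scalerDr -(scaler_nat _ v) !scalerA.
    by congr (_ + _ *: _); [rewrite -[RHS]scale1r; congr (_ *: _); field|field].
  (* On the left half, [2 * t] is approximated and averaged with [y]; on the right half, [2 * t - 1]
     and averaged with [y + u]. Either way the error halves. *)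
  have [t2|t2] := leP t 2^-1.
    have [|s As ts] := ih (2 * t); first lra.
    exists (s / 2).
      exists (y + s *: u) => //; exists y; last exact: mid.
      exact: (sub_iter_midpoints _ _ _ _ _ (leq_addl n m)).
    have -> : t - s / 2 = 2^-1 * (2 * t - s) by field.
    by rewrite normrM ger0_norm// exprS; apply: ler_wpM2l.
  have [|s As ts] := ih (2 * t - 1); first lra.
  exists ((s + 1) / 2).
    exists (y + s *: u) => //; exists (y + u).
      exact: (sub_iter_midpoints _ _ _ _ _ (leq_addl n m)).
    rewrite (_ : y + s *: u + (y + u) = y + (s + 1) *: u + y) ?mid//.
    by rewrite scalerDl scale1r [in RHS]addrAC [in RHS]addrA addrACA addrA.
  have -> : t - (s + 1) / 2 = 2^-1 * (2 * t - 1 - s) by field.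
  by rewrite normrM ger0_norm// exprS; apply: ler_wpM2l.
move=> z y l; rewrite !inE => Gz Gy e e0.
have e4 : 0 < e / 2 by lra.
have [m1 [z' Az' zz']] := Gz _ e4; have [m2 [y' Ay' yy']] := Gy _ e4.
pose m := maxn m1 m2; pose t : R := l%:num.
have t01 : 0 <= t <= 1 by rewrite /t ge0 le1.
(* Chosen so that [2 ^+ n] exceeds this ratio: the parameter error then moves the point by less than
   [e / 2]. *)
pose n := Num.bound (`|z' - y'| / (e / 2)).
have [|||s As ts] := bisect y' (z' - y') m n t => //.
- exact: (sub_iter_midpoints _ _ _ _ _ (leq_maxr m1 m2)).
- rewrite addrC subrK.
  exact: (sub_iter_midpoints _ _ _ _ _ (leq_maxl m1 m2)).
exists (n + m)%N, (y' + s *: (z' - y')) => //.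
change (`|(t *: z + (1 - t) *: y) - (y' + s *: (z' - y'))| < e).
have -> : (t *: z + (1 - t) *: y) - (y' + s *: (z' - y')) =
   t *: (z - z') + (1 - t) *: (y - y') + (t - s) *: (z' - y').
  rewrite (scalerBl t s) [RHS]addrA (addrAC (t *: (z - z'))) -scalerDr.
  rewrite (addrA (z - z')) subrK !(scalerBr _ _ y') addrACA -opprD -scalerDl.
  by rewrite subrKC scale1r opprD addrA.
have small : `|(t - s) *: (z' - y')| < e / 2.
  rewrite normrZ; apply: le_lt_trans (ler_wpM2r (normr_ge0 _) ts) _.
  have := upper_nthrootP (leqnn n); rewrite ltr_pdivrMr// => h.
  by rewrite exprVn mulrC ltr_pdivrMr ?exprn_gt0// mulrC.
apply: le_lt_trans (ler_normD _ _) _.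
have : `|t *: (z - z') + (1 - t) *: (y - y')| <= e / 2.
  apply: le_trans (ler_normD _ _) _; rewrite !normrZ !ger0_norm; [|lra..].
  have : t * `|z - z'| <= t * (e / 2) by apply: ler_wpM2l; lra.
  have : (1 - t) * `|y - y'| <= (1 - t) * (e / 2) by apply: ler_wpM2l; lra.
  lra.
lra.
Qed.

(** * Riemann sums and tagged partitions *)

Lemma minkowski_sumP (R : realType) (X : normedModType R) (n : nat)
    (l : 'I_n -> R) (A : 'I_n -> set X) (x : X) :
  (\big[minkowski_add / [set 0]]_(i < n) minkowski_scale (l i) (A i)) x <->
  exists2 a : 'I_n -> X, forall i, A i (a i) & x = \sum_i l i *: a i.
Proof.
elim: n l A x => [|n ih] l A x.
  rewrite big_ord0; split=> [->|[a _ ->]]; last by rewrite big_ord0.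
  by exists (fun=> 0); [case|rewrite big_ord0].
rewrite big_ord_recl; split.
  move=> [_ [a0 Aa0 <-]] [y /ih[a Aa ->] <-].
  exists (fun i => if unlift ord0 i is Some j then a j else a0).
    by move=> i; case: (unliftP ord0 i) => [j|] ->.
  rewrite big_ord_recl unlift_none; congr (_ + _).
  by apply: eq_bigr => i _; rewrite liftK.
move=> [a Aa ->]; rewrite big_ord_recl.
exists (l ord0 *: a ord0); first by exists (a ord0).
exists (\sum_(i < n) l (lift ord0 i) *: a (lift ord0 i)) => //.
by apply/ih; exists (a \o lift ord0).
Qed.

Lemma nth_cuts_in01 (R : realType) (P : tagged_partition R) (i : nat) :
  (i <= size (cuts P))%N -> 0 <= (0 :: cuts P)`_i <= 1.
Proof.
move=> iP; have hP := cuts_partition P.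
(* The index is in range, so the default may become the right endpoint [1], as the [itv_partition]
   lemmas expect. *)
rewrite (set_nth_default 1) //.
by rewrite itv_partition_nth_ge// itv_partition_nth_le.
Qed.

Lemma tag_in01 (R : realType) (P : tagged_partition R) (i : 'I_(size (cuts P))) :
  0 <= (tags P)`_i <= 1.
Proof.
have /andP[h1 h2] := tags_in (ltn_ord i).
have /andP[h3 _] := nth_cuts_in01 _ P _ (ltnW (ltn_ord i)).
have /andP[_ h4] := nth_cuts_in01 _ P _ (ltn_ord i).
by rewrite (le_trans h3 h1) (le_trans h2 h4).
Qed.

Lemma seg_length_mesh (R : realType) (P : tagged_partition R)
    (i : 'I_(size (cuts P))) :
  0 <= seg_length P i <= mesh P.
Proof.
apply/andP; split.
  have /andP[h1 h2] := tags_in (ltn_ord i).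
  by rewrite subr_ge0 (le_trans h1).
exact: (le_bigmax 0 (fun i : 'I__ => seg_length P i)).
Qed.

Lemma sum_seg_length (R : realType) (P : tagged_partition R) :
  \sum_(i < size (cuts P)) seg_length P i = 1.
Proof.
rewrite -(big_mkord xpredT (seg_length P)).
rewrite (@telescope_sumr _ _ _ (fun i => (0 :: cuts P)`_i))//.
by rewrite (itv_partition_nth_size _ (cuts_partition P)) subr0.
Qed.

Lemma mesh_ge0 (R : realType) (P : tagged_partition R) : 0 <= mesh P.
Proof. by rewrite /mesh; apply/bigmax_geP; left. Qed.

Lemma bounded_multifunctionP (R : realType) (X : normedModType R)
    (F : R -> set X) :
  bounded_multifunction F ->
  exists2 M : R, 0 <= M & forall t, 0 <= t <= 1 -> forall a, F t a -> `|a| <= M.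
Proof.
rewrite /bounded_multifunction /norm_sup; set s := ereal_sup _ => sfin.
exists (Num.max 0 (fine s)); first by rewrite le_max lexx.
move=> t t01 a Fa; rewrite le_max; apply/orP; right.
have h : (`|a|%:E <= s)%E.
  by apply: ereal_sup_ubound; exists a => //; exists t => //=; rewrite in_itv.
rewrite -lee_fin fineK// fin_numE -ltey sfin andbT gt_eqF//.
exact: lt_le_trans (ltNyr _) h.
Qed.

(** * Comparison of the Riemann sums of [F] and of its convex hull *)

Lemma riemann_sum_conv_sub (R : realType) (X : normedModType R)
    (F : R -> set X) (P : tagged_partition R) :
  riemann_sum F P `<=` riemann_sum (fun t => convex_hull (F t)) P.
Proof.
move=> x /minkowski_sumP[a Fa ->]; apply/minkowski_sumP; exists a => // i.
exact: sub_smallest (Fa i).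
Qed.

(** Hull points are moved to iterated midpoints and then rounded to values of [F]. The rounding
    constant [K] depends neither on the depth nor on the partition, so one [d] serves all
    partitions. *)
Lemma riemann_sum_conv_close (R : realType) (X : normedModType R)
    (F : R -> set X) (hX : nontrivial_infratype X)
    (F_bounded : bounded_multifunction F) (e : R) (e0 : 0 < e) :
  exists2 d, 0 < d & forall P : tagged_partition R, mesh P <= d ->
    forall x, riemann_sum (fun t => convex_hull (F t)) P x ->
    exists2 y, riemann_sum F P y & `|x - y| < e.
Proof.
have [p [C [p1 hC]]] := hX.
have [M M0 FM] := bounded_multifunctionP _ _ _ F_bounded.
have t0 : 0 < 1 - p^-1 by rewrite subr_gt0 invf_lt1// (lt_trans _ p1).
have := fun n l A x d => @iter_midpoints_rounding R X p C M p1 hC M0 n l A x d.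
set K := _ / _; set t := 1 - p^-1 => rounding.
(* Makes [|K| * r < e / 2]; the threshold [r]^ t^-1[then forces]mesh P [^ t <= r]. *)
pose r := e / 2 / (`|K| + 1).
have K1 : 0 < `|K| + 1 by rewrite ltr_wpDl.
have r0 : 0 < r by rewrite !divr_gt0.
exists (r `^ t^-1); first exact: powR_gt0.
move=> P Pd x /minkowski_sumP[b Fb ->].
have /choice[m hm] : forall i : 'I_(size (cuts P)), exists m,
    exists2 y, iter m midpoints (F (tags P)`_i) y & `|b i - y| < e / 2.
  by move=> i; apply: convex_hull_midpoints => //; lra.
(* Rounding needs one depth for all segments: the maximum of the individual depths. *)
have /choice[y hy] : forall i : 'I_(size (cuts P)), exists y,
    iter (\max_i m i) midpoints (F (tags P)`_i) y /\ `|b i - y| < e / 2.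
  move=> i; have [y Fy by_] := hm i; exists y; split => //.
  by apply: sub_iter_midpoints Fy; exact: leq_bigmax.
have [|||||a [Fa ya]] := rounding (\max_i m i)%N _ (seg_length P \o val)
  (fun i : 'I_(size (cuts P)) => F (tags P)`_i) y (mesh P) => //.
- exact: seg_length_mesh.
- by rewrite /= sum_seg_length.
- exact: mesh_ge0.
- by move=> i; apply: FM; exact: tag_in01.
- by move=> i; exact: (hy i).1.
exists (\sum_(i < size (cuts P)) seg_length P i *: a i).
  by apply/minkowski_sumP; exists a.
rewrite -sumrB.
have -> : \sum_(i < size (cuts P)) (seg_length P i *: b i - seg_length P i *: a i)
  = \sum_(i < size (cuts P)) seg_length P i *: (b i - y i) +
    \sum_(i < size (cuts P)) seg_length P i *: (y i - a i).
  rewrite -big_split/=; apply: eq_bigr => i _.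
  by rewrite -scalerDr addrA subrK scalerBr.
apply: le_lt_trans (ler_normD _ _) _.
have : `|\sum_(i < size (cuts P)) seg_length P i *: (b i - y i)| <= e / 2.
  apply: le_trans (ler_norm_sum _ _ _) _.
  apply: le_trans (_ : \sum_(i < size (cuts P)) seg_length P i * (e / 2) <= _).
    apply: ler_sum => i _; have /andP[l0 _] := seg_length_mesh _ _ i.
    by rewrite normrZ ger0_norm//; apply: ler_wpM2l => //; exact/ltW/(hy i).2.
  by rewrite -mulr_suml sum_seg_length mul1r.
suff : K * mesh P `^ t < e / 2 by move: ya; rewrite /=; lra.
have rt : mesh P `^ t <= r.
  have -> : r = (r `^ t^-1) `^ t.
    by rewrite -powRrM mulVf ?gt_eqF// powRr1// ltW.
  by apply: ge0_ler_powR; rewrite ?nnegrE ?mesh_ge0 ?powR_ge0// ltW.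
apply: le_lt_trans (_ : `|K| * r < _).
  apply: le_trans (_ : `|K| * mesh P `^ t <= _).
    by apply: ler_wpM2r; [exact: powR_ge0 | exact: ler_norm].
  exact: ler_wpM2l.
by rewrite /r mulrCA gtr_pMr ?ltr_pdivrMr ?mul1r ?ltrDl//; lra.
Qed.

(** * Convergence in the Hausdorff distance *)

Lemma hausdorff_distC (R : realType) (X : normedModType R) (A B : set X) :
  hausdorff_dist A B = hausdorff_dist B A.
Proof. exact: maxC. Qed.

Lemma hausdorff_dist_lt (R : realType) (X : normedModType R) (A B : set X)
    (e : R) :
  (hausdorff_dist A B < e%:E)%E ->
  forall a, A a -> exists2 b, B b & `|a - b| < e.
Proof.
rewrite /hausdorff_dist gt_max => /andP[h _] a Aa.
have : (edist_inf B a < e%:E)%E.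
  by apply: le_lt_trans h; apply: ereal_sup_ubound; exists a.
move=> /ereal_inf_lt[_ [b Bb <-]] /edist_lt_ball/=.
by rewrite -ball_normE; exists b.
Qed.

Lemma hausdorff_dist_le (R : realType) (X : normedModType R) (A B : set X)
    (e : R) :
  (forall a, A a -> exists2 b, B b & `|a - b| < e) ->
  (forall b, B b -> exists2 a, A a & `|b - a| < e) ->
  (hausdorff_dist A B <= e%:E)%E.
Proof.
move=> AB BA.
have half (U V : set X) : (forall u, U u -> exists2 v, V v & `|u - v| < e) ->
    (ereal_sup [set edist_inf V u | u in U] <= e%:E)%E.
  move=> UV; apply: ge_ereal_sup => _ [u /UV[v Vv uv] <-].
  apply: le_trans (_ : edist (u, v) <= _)%E.
    by apply: ereal_inf_lbound; exists v.
  apply: edist_fin; first exact: le_lt_trans uv.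
  by rewrite -ball_normE.
by rewrite /hausdorff_dist ge_max !half.
Qed.

(** Nonemptiness of [A] makes the distance nonnegative; a real upper bound then makes it finite,
    which reduces the limit to one in the reals. *)
Lemma hausdorff_dist_cvg0 (R : realType) (X : normedModType R)
    (U : nat -> set X) (A : set X) :
  A !=set0 ->
  hausdorff_dist (U k) A @[k --> \oo] --> 0%E <->
  (forall e, 0 < e -> \forall k \near \oo, (hausdorff_dist (U k) A < e%:E)%E).
Proof.
move=> [a0 Aa0].
have ge0 k : (0 <= hausdorff_dist (U k) A)%E.
  rewrite /hausdorff_dist le_max; apply/orP; right.
  apply: le_trans (edist_inf_ge0 (U k) a0) _.
  by apply: ereal_sup_ubound; exists a0.
split=> [h e e0|h].
  exact: (h _ (open_ereal_lt' _)).
apply/fine_cvgP; split.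
  have := h 1 ltr01; apply: filterS => k hk.
  by rewrite ge0_fin_numE// (lt_trans hk)// ltry.
apply/cvgr0Pnorm_lt => e e0; have := h e e0; apply: filterS => k hk /=.
have kfin : hausdorff_dist (U k) A \is a fin_num.
  by rewrite ge0_fin_numE// (lt_trans hk)// ltry.
by rewrite ger0_norm ?fine_ge0// -lte_fin fineK.
Qed.

Lemma hausdorff_cvg_close (R : realType) (X : normedModType R)
    (U V : nat -> set X) (A : set X) :
  A !=set0 ->
  (forall e, 0 < e -> \forall k \near \oo,
    (forall u, U k u -> exists2 v, V k v & `|u - v| < e) /\
    (forall v, V k v -> exists2 u, U k u & `|v - u| < e)) ->
  hausdorff_dist (U k) A @[k --> \oo] --> 0%E ->
  hausdorff_dist (V k) A @[k --> \oo] --> 0%E.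
Proof.
move=> A0 UV /(hausdorff_dist_cvg0 _ _ _ _ A0) UA.
apply/(hausdorff_dist_cvg0 _ _ _ _ A0) => e e0.
(* Two moves of [e / 4] give [e / 2], leaving room because [hausdorff_dist_le] yields only a weak
   inequality. *)
have e4 : 0 < e / 4 by lra.
have trans (B D E : set X) :
    (forall b, B b -> exists2 d, D d & `|b - d| < e / 4) ->
    (forall d, D d -> exists2 f, E f & `|d - f| < e / 4) ->
    forall b, B b -> exists2 f, E f & `|b - f| < e / 2.
  move=> BD DE b /BD[d /DE[f Ef df] bd]; exists f => //.
  by have := ler_distD d b f; lra.
apply: filterS2 _ (UV _ e4) (UA _ e4) => k [hUV hVU] hUA.
apply: le_lt_trans (_ : (e / 2)%:E < _)%E; last by rewrite lte_fin; lra.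
apply: hausdorff_dist_le.
  exact: trans hVU (hausdorff_dist_lt _ _ _ _ _ hUA).
by apply: trans hUV; apply: hausdorff_dist_lt; rewrite hausdorff_distC.
Qed.

Theorem theorem2p4 (R : realType) (X : completeNormedModType R)
    (F : R -> set X)
    (hX : nontrivial_infratype X)
    (F_neq0 : forall t : R, 0 <= t <= 1 -> F t !=set0)
    (F_bounded : bounded_multifunction F) :
  riemann_limits F = riemann_limits (fun t => convex_hull (F t)).
Proof.
have close (P : nat -> tagged_partition R) : mesh (P k) @[k --> \oo] --> 0 ->
    forall e, 0 < e -> \forall k \near \oo,
    (forall u, riemann_sum F (P k) u ->
       exists2 v, riemann_sum (fun t => convex_hull (F t)) (P k) v &
         `|u - v| < e) /\
    (forall v, riemann_sum (fun t => convex_hull (F t)) (P k) v ->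
       exists2 u, riemann_sum F (P k) u & `|v - u| < e).
  move=> P0 e e0; have [d d0 hd] := riemann_sum_conv_close _ _ _ hX F_bounded _ e0.
  have Pd : \forall k \near \oo, mesh (P k) < d by exact: cvgr_lt P0 _ d0.
  apply: filterS Pd => k /ltW kd; split=> [u Fu|].
    by exists u; [exact: riemann_sum_conv_sub | rewrite subrr normr0].
  exact: hd.
apply/seteqP; split=> A [A0 [clA [P [P0 PA]]]]; split=> //; split=> //; exists P.
  split=> //; exact: hausdorff_cvg_close A0 (close P P0) PA.
(* The reverse inclusion uses the same partitions with the two closeness statements exchanged. *)
split=> //; apply: hausdorff_cvg_close A0 _ PA => e e0.
by have := close P P0 e e0; apply: filterS => k [].
Qed.
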